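(* If $C\subseteq\mathbb{R}^n$ is a closed cone, then $$N^i_C(0;d)=N_C(0;d)=N_C(d)\qquad\forall d\in\mathbb{R}^n.$$
   Context: For $C\subseteq\mathbb{R}^n$: the regular (Fréchet) normal cone is $\widehat N_C(z)=\{v:\langle v,z'-z\rangle\le o(\|z'-z\|)\ \forall z'\in C\}$ for $z\in C$; the limiting (Mordukhovich) normal cone at $z\in C$ is $N_C(z)=\{\lim v_k: v_k\in\widehat N_C(z_k),\ z_k\in C,\ z_k\to z\}$; both are taken to be $\emptyset$ for $z\notin C$. For $z\in C$ and $d\in\mathbb{R}^n$, the directional limiting normal cone is $N_C(z;d)=\{v:\exists t_k\downarrow0,\ d_k\to d,\ v_k\to v\text{ with }v_k\in\widehat N_C(z+t_kd_k)\ \forall k\}$, and the inner directional limiting normal cone is $N^i_C(z;d)=\{v:\forall t_k\downarrow0\ \exists d_k\to d,\ v_k\to v\text{ with }v_k\in\widehat N_C(z+t_kd_k)\ \forall k\}$ ($t_k\downarrow0$ means $t_k>0$, $t_k\to0$). A closed cone is nonempty, hence contains $0$. *)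

(* Defs.v *)
From mathcomp Require Import all_boot all_order all_algebra.
From mathcomp Require Import all_classical all_reals all_analysis.

Set Implicit Arguments.
Unset Strict Implicit.
Unset Printing Implicit Defensive.

Import Order.TTheory GRing.Theory Num.Theory numFieldNormedType.Exports.

Local Open Scope classical_set_scope.
Local Open Scope ring_scope.

Definition dotv (R : realType) (n : nat) (u v : 'rV[R]_n) : R :=
  \sum_(i < n) u 0 i * v 0 i.

(* The library norm `|v| on 'rV[R]_n is the sup norm; [enorm] is the Euclidean
   norm.  Both induce the product topology carried by 'rV[R]_n. *)
Definition enorm (R : realType) (n : nat) (v : 'rV[R]_n) : R :=
  Num.sqrt (dotv v v).

(* Frechet normals, empty when z is not in C.  For z' in C,
   <v, z' - z> <= o(|z' - z|) means that for every e > 0 the bound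
   <v, z' - z> <= e |z' - z| holds for all z' in C close enough to z. *)
Definition regular_normal_cone (R : realType) (n : nat) (C : set 'rV[R]_n)
    (z : 'rV[R]_n) : set 'rV[R]_n :=
  [set v | C z /\
    forall e : R, 0 < e ->
      \forall z' \near z, C z' -> dotv v (z' - z) <= e * enorm (z' - z)].

(* Mordukhovich normals, empty when z is not in C. *)
Definition limiting_normal_cone (R : realType) (n : nat) (C : set 'rV[R]_n)
    (z : 'rV[R]_n) : set 'rV[R]_n :=
  [set v | C z /\
    exists zk vk : nat -> 'rV[R]_n,
      [/\ zk @ \oo --> z, vk @ \oo --> v &
          forall k, C (zk k) /\ regular_normal_cone C (zk k) (vk k)]].

(* As in the convention t_k \downarrow 0, monotonicity is not required. *)
Definition decreases_to_0 (R : realType) (t : nat -> R) : Prop :=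
  (forall k, 0 < t k) /\ t @ \oo --> (0 : R).

Definition dir_limiting_normal_cone (R : realType) (n : nat)
    (C : set 'rV[R]_n) (z d : 'rV[R]_n) : set 'rV[R]_n :=
  [set v | exists (t : nat -> R) (dk vk : nat -> 'rV[R]_n),
    [/\ decreases_to_0 t, dk @ \oo --> d, vk @ \oo --> v &
        forall k, regular_normal_cone C (z + t k *: dk k) (vk k)]].

Definition inner_dir_limiting_normal_cone (R : realType) (n : nat)
    (C : set 'rV[R]_n) (z d : 'rV[R]_n) : set 'rV[R]_n :=
  [set v | forall t : nat -> R, decreases_to_0 t ->
    exists dk vk : nat -> 'rV[R]_n,
    [/\ dk @ \oo --> d, vk @ \oo --> v &
        forall k, regular_normal_cone C (z + t k *: dk k) (vk k)]].

(* A closed cone in this sense contains 0, as the limit of t *: x for t -> 0+. *)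
Definition closed_cone (R : realType) (n : nat) (C : set 'rV[R]_n) : Prop :=
  [/\ C !=set0, closed C &
      forall (t : R) (x : 'rV[R]_n), 0 < t -> C x -> C (t *: x)].

(* Main.v *)
Require Import Defs.
From mathcomp Require Import all_boot all_order all_algebra.
From mathcomp Require Import all_classical all_reals all_analysis.
Import Order.TTheory GRing.Theory Num.Theory numFieldNormedType.Exports.
Local Open Scope classical_set_scope.
Local Open Scope ring_scope.

(* The regular normal cone of a cone C is the same at x and at t x for t > 0,
   so the points 0 + t_k d_k in the directional cones may be replaced by d_k,
   whatever the sequence t_k; closedness of C puts the limit d in C. *)

Lemma dotvZr (R : realType) (n : nat) (a : R) (u v : 'rV[R]_n) :
  dotv u (a *: v) = a * dotv u v.
Proof.
by rewrite /dotv mulr_sumr; apply: eq_bigr => i _; rewrite mxE mulrCA.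
Qed.

Lemma enormZ (R : realType) (n : nat) (a : R) (v : 'rV[R]_n) :
  enorm (a *: v) = `|a| * enorm v.
Proof.
rewrite /enorm dotvZr.
have -> : dotv (a *: v) v = a * dotv v v.
  by rewrite /dotv mulr_sumr; apply: eq_bigr => i _; rewrite mxE mulrA.
by rewrite mulrA -expr2 sqrtrM ?sqr_ge0// sqrtr_sqr.
Qed.

(** Scaling by [t^-1] sends points of [C] near [t *: x] to points of [C] near [x], where the
    inequality for [v] is available with the same [e]. *)
Lemma regular_normal_coneZ (R : realType) (n : nat) (C : set 'rV[R]_n)
    (t : R) (x v : 'rV[R]_n) :
  (forall (s : R) (y : 'rV[R]_n), 0 < s -> C y -> C (s *: y)) -> 0 < t ->
  regular_normal_cone C x v -> regular_normal_cone C (t *: x) v.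
Proof.
move=> coneC t0 [Cx hv]; split; first exact: coneC.
move=> e e0.
have tV : t^-1 * t = 1 by rewrite mulVf// gt_eqF.
have cvx : t^-1 *: z @[z --> t *: x] --> x.
  (* The limit [x] is written as [t^-1 *: (t *: x)], which makes this continuity of scaling at
     [t *: x]. *)
  by rewrite -[X in _ --> X]scale1r -tV -scalerA; exact: scaler_continuous.
have : \forall z' \near t *: x, C (t^-1 *: z') ->
    dotv v (t^-1 *: z' - x) <= e * enorm (t^-1 *: z' - x).
  exact: cvx _ (hv e e0).
apply: filterS => z' hz' Cz'.
(* Both sides of the inequality are positively homogeneous in the displacement, so the factor [t]
   cancels. *)
have -> : z' - t *: x = t *: (t^-1 *: z' - x).
  by rewrite scalerBr scalerA mulrC tV scale1r.
rewrite dotvZr enormZ gtr0_norm// mulrCA ler_pM2l//.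
by apply: hz'; apply: coneC; rewrite ?invr_gt0.
Qed.

Theorem proposition3p4 (R : realType) (n : nat) (C : set 'rV[R]_n)
    (hC : closed_cone C) :
  forall d : 'rV[R]_n,
    inner_dir_limiting_normal_cone C 0 d = dir_limiting_normal_cone C 0 d /\
    dir_limiting_normal_cone C 0 d = limiting_normal_cone C d.
Proof.
move=> d; case: hC => _ clC coneC.
have inner_dir : inner_dir_limiting_normal_cone C 0 d `<=`
    dir_limiting_normal_cone C 0 d.
  move=> v hv.
  (* One admissible sequence suffices to instantiate the universal quantifier over [t]; [1/(k+1)] is
     chosen. *)
  have t0 : decreases_to_0 (@harmonic R).
    by split; [exact: harmonic_gt0|exact: cvg_harmonic].
  by have [dk [vk hk]] := hv _ t0; exists harmonic, dk, vk; case: hk.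
have dir_lim : dir_limiting_normal_cone C 0 d `<=` limiting_normal_cone C d.
  move=> v [t [dk [vk [[t0 _] dkd vkv hk]]]].
  have hdk k : regular_normal_cone C (dk k) (vk k).
    (* Undoing the scaling by [t k] moves the normal [vk k] back to [dk k]. *)
    have -> : dk k = (t k)^-1 *: (0 + t k *: dk k).
      by rewrite add0r scalerA mulVf ?scale1r// gt_eqF.
    by apply: regular_normal_coneZ; rewrite ?invr_gt0.
  have Cdk k : C (dk k) by case: (hdk k).
  split; last by exists dk, vk.
  by apply: (closed_cvg _ clC _ _ dkd); exact: nearW.
have lim_inner : limiting_normal_cone C d `<=`
    inner_dir_limiting_normal_cone C 0 d.
  move=> v [_ [zk [vk [zkd vkv hk]]]] t [t0 _].
  (* The same witnesses serve every [t]: [vk k] stays normal when [zk k] is scaled by [t k]. *)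
  exists zk, vk; split=> // k; rewrite add0r.
  by apply: regular_normal_coneZ => //; case: (hk k).
(* The three inclusions form a cycle; the two reverse inclusions follow by composition. *)
split; apply/seteqP; split=> //.
- exact: subset_trans dir_lim lim_inner.
- exact: subset_trans lim_inner inner_dir.
Qed.
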